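(* Let $V$ be a topological vector space over $\mathbb{K}$ and let $\alpha\geq w(V)$ be an infinite cardinal. Let $M$ be a nonempty subset of $V$ for which there is a nonempty subset $N$ of $V$ such that (i) $M$ is stronger than $N$, i.e. $M+N\subset M$; (ii) $M\cap N=\varnothing$; (iii) $N$ is dense lineable in $V$. If $M$ is pointwise $\alpha$-lineable, then $M$ is infinitely pointwise $\alpha$-dense lineable in $V$.
   Context: $\mathbb{K}$ is the scalar field ($\mathbb{R}$ or $\mathbb{C}$). $w(V)$ denotes the weight of $V$, i.e. the smallest cardinality of a base for the topology of $V$. ''Dimension'' means the cardinality of a Hamel basis. For subsets $M,N\subset V$, $M$ is stronger than $N$ if $M+N=\{m+n: m\in M,\ n\in N\}\subset M$. $N$ is dense lineable in $V$ if there is a dense vector subspace $E$ of $V$ with $E\subset N\cup\{0\}$. A nonempty subset $M$ of $V$ is pointwise $\alpha$-lineable if for every $x\in M$ there is a vector subspace $W_x$ of $V$ with $x\in W_x$, $\dim(W_x)=\alpha$ and $W_x\subset M\cup\{0\}$. For $\alpha$ an infinite cardinal, $M$ is infinitely pointwise $\alpha$-dense lineable in $V$ if for every $x\in M$ there is a family $\{W_n:n\in\mathbb{N}\}$ of vector subspaces of $V$ such that: for each $n$, $W_n$ is dense in $V$, $\dim(W_n)=\alpha$ and $x\in W_n\subset M\cup\{0\}$; and $W_m\cap W_n=\mathbb{K}x$ whenever $m\neq n$. *)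

(* Defs.v *)
From HB Require Import structures.
From mathcomp Require Import all_boot all_order all_algebra.
From mathcomp Require Import complex.
From mathcomp Require Import boolp classical_sets functions cardinality reals.
From mathcomp Require Import topology normedtype.

Set Implicit Arguments.
Unset Strict Implicit.
Unset Printing Implicit Defensive.

Import Order.TTheory GRing.Theory Num.Theory.
Import numFieldNormedType.Exports.

Local Open Scope classical_set_scope.
Local Open Scope card_scope.
Local Open Scope ring_scope.

(* Cardinals are represented by sets, compared with [#<=] and [#=]. *)

(* [kappa] has the smallest cardinality of a base for the topology of [T];
   this determines [kappa] up to equipotence. *)
Definition is_weight (T : topologicalType) (J : Type) (kappa : set J) : Prop :=
  (exists2 B : set (set T), basis B & B #= kappa) /\
  (forall B : set (set T), basis B -> kappa #<= B).

Definition is_real_or_complex (K : numFieldType) : Prop :=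
  exists R : realType, K = R :> numFieldType \/ K = R[i]%C :> numFieldType.

Section LinearAlgebra.
Context {K : numFieldType} {V : lmodType K}.
Implicit Types W B : set V.

Definition linear_subspace W : Prop := GRing.submod_closed [in W].

Definition linear_span B : set V :=
  [set x | exists (s : seq V) (a : V -> K),
     {subset s <= B} /\ x = \sum_(v <- s) a v *: v].

Definition linearly_independent B : Prop :=
  forall (s : seq V) (a : V -> K), uniq s -> {subset s <= B} ->
    \sum_(v <- s) a v *: v = 0 -> {in s, forall v, a v = 0}.

Definition hamel_basis W B : Prop :=
  linearly_independent B /\ linear_span B = W.

Definition has_dim W (I : Type) (alpha : set I) : Prop :=
  exists2 B : set V, hamel_basis W B & B #= alpha.

Definition stronger (M N : set V) : Prop :=
  [set m + n | m in M & n in N] `<=` M.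

Definition pointwise_lineable (I : Type) (alpha : set I) (M : set V) : Prop :=
  forall x, M x -> exists W : set V,
    [/\ linear_subspace W, W x, has_dim W alpha & W `<=` M `|` [set 0]].

End LinearAlgebra.

Section TopologicalVectorSpace.
(* [topologicalLmodType] requires neither local convexity nor separation. *)
Context {K : numFieldType} {V : topologicalLmodType K}.

Definition dense_lineable (N : set V) : Prop :=
  exists E : set V, [/\ linear_subspace E, dense E & E `<=` N `|` [set 0]].

Definition infinitely_pointwise_dense_lineable (I : Type) (alpha : set I)
    (M : set V) : Prop :=
  forall x, M x -> exists W : nat -> set V,
    (forall n, [/\ linear_subspace (W n), dense (W n), has_dim (W n) alpha,
                   W n x & W n `<=` M `|` [set 0]]) /\
    (forall m n, m <> n -> W m `&` W n = range (fun a : K => a *: x)).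

End TopologicalVectorSpace.

(* Main.v *)
(* Let E be the dense subspace inside N `|` [set 0] and W the subspace given at
   x by pointwise lineability. Disjointness of M and N forces W and E to meet
   only at 0, and M + N `<=` M puts every vector w + e (w nonzero in W, e in E)
   in M. Outside a finite part of a Hamel basis H of W that spans x, one finds
   distinct vectors w n h of H indexed by nat * H, since H * nat has the
   cardinality of H. For each n, let h range over a set containing a copy of a
   base of V and replace w n h by c *: w n h + e with c != 0, e in E, landing in
   the prescribed basic open set: this is possible as E is dense. These vectors,
   together with x, are linearly independent modulo E, so their spans W_n avoid
   E away from 0, and W_m, W_n only share the line through x. *)

Require Import Defs.
From HB Require Import structures.
From mathcomp Require Import all_boot all_order all_algebra.
From mathcomp Require Import complex.
From mathcomp Require Import boolp classical_sets functions cardinality reals.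
From mathcomp Require Import topology normedtype.

Set Implicit Arguments.
Unset Strict Implicit.
Unset Printing Implicit Defensive.

Import Order.TTheory GRing.Theory Num.Theory.
Import numFieldNormedType.Exports.

Local Open Scope classical_set_scope.
Local Open Scope card_scope.
Local Open Scope ring_scope.

(** * Cardinals of infinite sets and of their products with [nat] *)

Lemma inj_homo_card_le (T U : Type) (A : set T) (B : set U) (f : T -> U) :
  {homo f : x / A x >-> B x} -> {in A &, injective f} -> A #<= B.
Proof.
move=> fAB finj; apply: (@card_le_trans _ _ _ (f @` A)).
  by have := inj_card_eq finj; rewrite card_eq_le => /andP[].
by apply: subset_card_le => _ [x Ax <-]; exact: fAB.
Qed.

Lemma card_le_inj_homo (T U : Type) (A : set T) (B : set U) :
  A #<= B -> B !=set0 ->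
  exists2 f : T -> U, {homo f : x / A x >-> B x} & {in A &, injective f}.
Proof.
move=> AB [u0 _]; elim/Ppointed: U => U in B AB u0 *.
  by have := no u0.
move: AB => /pcard_leP[f]; exists f; [exact: funS|exact: inj].
Qed.

Lemma card_setX_nat_countable (T : Type) (C : set T) :
  C #= [set: nat] -> C `*` [set: nat] #<= C.
Proof.
move=> CN; have [f _ finj] : exists2 f : T -> nat,
    {homo f : x / C x >-> setT x} & {in C &, injective f}.
  apply: card_le_inj_homo; last by exists 0%N.
  by move: CN; rewrite card_eq_le => /andP[].
have le2 : [set: nat * nat] #<= C.
  by rewrite (card_le_eql card_nat2); move: CN; rewrite card_eq_le => /andP[].
apply: card_le_trans le2.
apply: (@inj_homo_card_le _ _ _ _ (fun p => (f p.1, p.2))) => //.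
move=> [x m] [y n] /set_mem[/= Cx _] /set_mem[/= Cy _] [fxy ->].
by congr pair; apply: finj => //; rewrite inE.
Qed.

(* A maximal family of disjoint countably infinite subsets of [A] leaves out
   only finitely many points of [A]; these are absorbed by one member. *)
Lemma card_setX_nat (T : Type) (A : set T) :
  infinite_set A -> A `*` [set: nat] #<= A.
Proof.
move=> Ainf; pose D := [set C : set T | C `<=` A /\ C #= [set: nat]].
have [F [FD Fdisj Fmax]] := ex_maximal_disjoint_subcollection id D.
set S := \bigcup_(C in F) C.
have SA : S `<=` A by move=> x [C /FD[+ _] Cx]; apply.
(* Otherwise the range of an injective sequence outside [S] could be added to [F], against
   maximality. *)
have Rfin : finite_set (A `\` S).
  apply: contrapT => /infiniteP NR.
  have [x0 Ax0] := infinite_setN0 Ainf.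
  have [f fR finj] : exists2 f : nat -> T,
      {homo f : x / setT x >-> (A `\` S) x} & {in setT &, injective f}.
    by apply: card_le_inj_homo => //; apply: infinite_setN0; exact/infiniteP.
  pose C := range f.
  have CS x : C x -> ~ S x by move=> [n _ <-]; have [] := fR n I.
  have CD : D C.
    split; first by move=> _ [n _ <-]; have [] := fR n I.
    exact: inj_card_eq.
  have C0 : C (f 0%N) by exists 0%N.
  apply: (Fmax (F `|` [set C])).
  - split; first by left.
    move=> /(_ C (or_intror erefl)) FC.
    by apply: (CS _ C0); exists C.
  - by move=> E [/FD//|->].
  - move=> E E' [FE|->] [FE'|->] [x [Ex E'x]] //.
    + by apply: Fdisj => //; exists x.
    + by exfalso; apply: (CS x) => //; exists E.
    + by exfalso; apply: (CS x) => //; exists E'.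
have [C0 FC0] : exists C, F C.
  have [x [Ax nAS]] : (A `\` (A `\` S)) !=set0.
    exact/infinite_setN0/infinite_setD.
  by have [C FC _] : S x; [apply: contrapT => nSx; apply: nAS|exists C].
(* The leftover points together with [C0] are still countable, so [k] squeezes them into [C0]. *)
pose R := (A `\` S) `|` C0.
have [_ C0nat] := FD _ FC0.
have C0ge : [set: nat] #<= C0 by move: C0nat; rewrite card_eq_le => /andP[].
have [k kC0 kinj] : exists2 k : T -> T,
    {homo k : x / R x >-> C0 x} & {in R &, injective k}.
  apply: card_le_inj_homo; last exact/infinite_setN0/infiniteP.
  apply: card_le_trans C0ge.
  rewrite /R -bigcup2E; apply: bigcup_countable => // -[|[|i]] _ /=.
  - exact: finite_set_countable.
  - by move: C0nat; rewrite card_eq_le => /andP[].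
  - exact: countable0.
have /choice[f fP] : forall C : set T, exists f : T * nat -> T, F C ->
    {homo f : x / (C `*` setT) x >-> C x} /\ {in C `*` setT &, injective f}.
  move=> C; have [FC|nFC] := pselect (F C); last by exists fst.
  have [_ Cnat] := FD _ FC.
  have [||g gC ginj] := @card_le_inj_homo _ _ (C `*` [set: nat]) C.
  - exact: card_setX_nat_countable.
  - apply/infinite_setN0/infiniteP.
    by move: Cnat; rewrite card_eq_le => /andP[].
  - by exists g.
have /choice[c cP] : forall x, exists C, S x -> F C /\ C x.
  move=> x; have [[C FC Cx]|nSx] := pselect (S x); first by exists C.
  by exists set0.
(* [l] embeds [A] into [S]: it is [k] on [R], and the other points of [A] already lie in [S] and
   outside [C0]. *)
pose l x := if x \in R then k x else x.
have lS x : A x -> S (l x).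
  move=> Ax; rewrite /l; case: ifPn => [/set_mem/kC0 C0x|/negP nRx].
    by exists C0.
  by apply: contrapT => nSx; apply: nRx; rewrite inE; left.
have linj x y : l x = l y -> x = y.
  rewrite /l; case: ifPn => Rx; case: ifPn => Ry //.
  - exact: kinj.
  - move=> e; move/negP: Ry => []; rewrite inE; right; rewrite -e.
    by apply: kC0; exact: set_mem.
  - move=> e; move/negP: Rx => []; rewrite inE; right; rewrite e.
    by apply: kC0; exact: set_mem.
apply: (@inj_homo_card_le _ _ _ _ (fun p => f (c (l p.1)) (l p.1, p.2))).
  move=> [x n] [/= Ax _]; have [FC Cx] := cP _ (lS _ Ax).
  by apply: SA; exists (c (l x)) => //; apply: (fP _ FC).1.
move=> [x m] [y n] /set_mem[/= Ax _] /set_mem[/= Ay _] e.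
have [FCx Cx] := cP _ (lS _ Ax); have [FCy Cy] := cP _ (lS _ Ay).
(* The common value lies in both pieces, and members of [F] that meet coincide. *)
have Cxy : c (l x) = c (l y).
  apply: Fdisj => //; exists (f (c (l x)) (l x, m)); split.
    exact: (fP _ FCx).1.
  by rewrite e; exact: (fP _ FCy).1.
have [] : (l x, m) = (l y, n).
  apply: (fP _ FCx).2; last by rewrite e Cxy.
  - exact/mem_set.
  - by apply/mem_set; split=> //=; rewrite Cxy.
by move=> /linj -> ->.
Qed.

(** * Spans and independence of indexed families modulo a subspace *)

Section IndexedSpan.
Context {K : numFieldType} {V : lmodType K}.
Implicit Types (W B D E : set V) (u : V -> V).

Lemma linear_subspace0 W : linear_subspace W -> W 0.
Proof. by move=> [W0 _]; exact: set_mem. Qed.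

Lemma linear_subspaceD W a x y :
  linear_subspace W -> W x -> W y -> W (a *: x + y).
Proof. by move=> [_ lW] Wx Wy; apply/set_mem/lW; exact: mem_set. Qed.

Lemma linear_subspaceZ W a x : linear_subspace W -> W x -> W (a *: x).
Proof.
move=> sW Wx; rewrite -[_ *: _]addr0.
by apply: linear_subspaceD => //; exact: linear_subspace0.
Qed.

Lemma linear_subspace_sum W (s : seq V) (a : V -> K) u :
  linear_subspace W -> (forall v, v \in s -> W (u v)) ->
  W (\sum_(v <- s) a v *: u v).
Proof.
move=> sW; elim: s => [_|v s IH Ws]; rewrite ?big_nil ?big_cons.
  exact: linear_subspace0.
apply: linear_subspaceD => //; first by apply: Ws; rewrite mem_head.
by apply: IH => w ws; apply: Ws; rewrite inE ws orbT.
Qed.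

(** Zero padding brings combinations over different lists to a common list, where they are compared
    coefficientwise. *)
Lemma sum_widen (s t : seq V) (a : V -> K) u :
  uniq s -> uniq t -> {subset s <= t} ->
  \sum_(v <- s) a v *: u v = \sum_(v <- t) (if v \in s then a v else 0) *: u v.
Proof.
move=> us ut st; rewrite [RHS](bigID (mem s))/= [X in _ + X]big1 ?addr0.
  rewrite -[RHS]big_filter (perm_big [seq v <- t | v \in s]); last first.
    apply: uniq_perm => // [|v]; first by rewrite filter_uniq.
    by rewrite mem_filter; have [/st ->|] := boolP (v \in s).
  by apply: eq_big_seq => v; rewrite mem_filter => /andP[-> _].
by move=> v /negbTE ->; rewrite scale0r.
Qed.

(** Coefficients are attached to the index [v] rather than to [u v], and [s] has no repetition, so
    independence applies directly, without injectivity of [u]. *)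
Definition indexed_span u D : set V :=
  [set y | exists (s : seq V) (a : V -> K),
     [/\ uniq s, {subset s <= D} & y = \sum_(v <- s) a v *: u v]].

Lemma indexed_span_subspace u D : linear_subspace (indexed_span u D).
Proof.
split=> [|k _ _ /set_mem[s [a [us sD ->]]] /set_mem[t [b [ut tD ->]]]].
  by apply/mem_set; exists [::], (fun=> 0); rewrite big_nil.
apply/mem_set; exists (undup (s ++ t)), (fun v =>
  k * (if v \in s then a v else 0) + (if v \in t then b v else 0)).
split; first exact: undup_uniq.
  by move=> v; rewrite mem_undup mem_cat => /orP[/sD|/tD].
rewrite (@sum_widen s (undup (s ++ t))) ?undup_uniq//; last first.
  by move=> v vs; rewrite mem_undup mem_cat vs.
rewrite (@sum_widen t (undup (s ++ t))) ?undup_uniq//; last first.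
  by move=> v vs; rewrite mem_undup mem_cat vs orbT.
rewrite scaler_sumr -big_split/=; apply: eq_bigr => v _.
by rewrite scalerDl scalerA.
Qed.

Lemma sub_indexed_span u D v : D v -> indexed_span u D (u v).
Proof.
move=> Dv; exists [:: v], (fun=> 1); split=> //.
  by move=> w; rewrite !inE => /eqP ->.
by rewrite big_seq1 scale1r.
Qed.

Lemma linear_span_min B W : linear_subspace W -> B `<=` W ->
  linear_span B `<=` W.
Proof.
move=> sW BW _ [s [a [sB ->]]].
by apply: linear_subspace_sum => // v /sB /set_mem /BW.
Qed.

Lemma linear_span_indexed B : linear_span B = indexed_span id B.
Proof.
apply/seteqP; split=> [|y [s [a [_ sB ->]]]]; last by exists s, a.
by apply: linear_span_min (indexed_span_subspace _ _) _ => v /sub_indexed_span.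
Qed.

Lemma linear_span_subspace B : linear_subspace (linear_span B).
Proof. by rewrite linear_span_indexed; exact: indexed_span_subspace. Qed.

Lemma sub_linear_span B : B `<=` linear_span B.
Proof. by move=> v Bv; rewrite linear_span_indexed; exact: sub_indexed_span. Qed.

Lemma linear_span_image u D : linear_span (u @` D) = indexed_span u D.
Proof.
apply/seteqP; split.
  apply: linear_span_min (indexed_span_subspace _ _) _ => _ [v Dv <-].
  exact: sub_indexed_span.
move=> _ [s [a [_ sD ->]]].
apply: linear_subspace_sum (linear_span_subspace _) _ => v /sD /set_mem Dv.
by apply: sub_linear_span; exists v.
Qed.

(** For a subspace [E], this is linear independence of the family of classes of the [u v] in the
    quotient of [V] by [E]. *)
Definition independent_mod E u D : Prop :=
  forall (s : seq V) (a : V -> K), uniq s -> {subset s <= D} ->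
    E (\sum_(v <- s) a v *: u v) -> {in s, forall v, a v = 0}.

Lemma independent_mod_sub E u D D' : D' `<=` D ->
  independent_mod E u D -> independent_mod E u D'.
Proof.
by move=> DD' ind s a us sD'; apply: ind => // v /sD' /set_mem /DD' /mem_set.
Qed.

Lemma independent_mod_inj E u D : linear_subspace E ->
  independent_mod E u D -> {in D &, injective u}.
Proof.
move=> sE ind v w Dv Dw uvw; apply/eqP; apply: contraT => vw.
have wv : (w == v) = false by rewrite eq_sym (negbTE vw).
have := ind [:: v; w] (fun z => if z == v then 1 else -1).
rewrite big_cons big_seq1 /= eqxx wv inE vw.
rewrite uvw scale1r scaleN1r subrr => /(_ isT) H.
have := H _ (linear_subspace0 sE) v; rewrite eqxx mem_head => H1.
have /eqP : (1 : K) = 0.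
  apply: H1 => // z.
  by rewrite !inE => /orP[] /eqP ->; exact: set_mem.
by rewrite oner_eq0.
Qed.

Lemma independent_mod_image E u D : linear_subspace E ->
  independent_mod E u D -> linearly_independent (u @` D).
Proof.
move=> sE ind s a us suD s0 v vs.
(* A section [r] of [u] on [s] turns a relation between images into one between indices. *)
have /choice[r rP] : forall w : V, exists z, w \in s -> D z /\ u z = w.
  move=> w; have [/suD /set_mem[z Dz zw]|_] := boolP (w \in s); by [exists z|exists w].
have urK : {in s, cancel r u} by move=> w /rP[].
have rinj : {in s &, injective r} by exact: can_in_inj urK.
rewrite -(urK v vs) -[a _]/((a \o u) (r v)).
apply: (ind (map r s)); last exact: map_f.
- by rewrite map_inj_in_uniq.
- by move=> _ /mapP[w /rP[Dw _] ->]; exact: mem_set.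
- rewrite big_map (eq_big_seq (fun w => a w *: w)) ?s0.
    exact: linear_subspace0.
  by move=> w /urK; rewrite /= => ->.
Qed.

Lemma indexed_spanI E u D D' : linear_subspace E ->
  independent_mod E u (D `|` D') ->
  indexed_span u D `&` indexed_span u D' = indexed_span u (D `&` D').
Proof.
move=> sE ind; apply/seteqP; split; last first.
  move=> _ [s [a [us sD ->]]]; split; exists s, a; split=> // v /sD;
  by rewrite !inE => -[].
move=> y [[s [a [us sD ys]]] [t [b [ut tD yt]]]].
pose r := undup (s ++ t).
have sr : {subset s <= r} by move=> v vs; rewrite mem_undup mem_cat vs.
have tr : {subset t <= r} by move=> v vs; rewrite mem_undup mem_cat vs orbT.
(* The difference of the two expansions of [y] is a zero combination over [r]; at a point of [s]
   outside [t] its coefficient is [a v]. *)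
have ab v : v \in s -> v \notin t -> a v = 0.
  move=> vs vt.
  have := ind r (fun v => (if v \in s then a v else 0)
                        - (if v \in t then b v else 0)).
  rewrite undup_uniq => /(_ isT) H; have := H _ _ v (sr _ vs).
  rewrite vs (negbTE vt) subr0; apply.
    by move=> w; rewrite mem_undup mem_cat => /orP[/sD|/tD] /set_mem Dw;
      apply/mem_set; [left|right].
  under eq_bigr do rewrite scalerBl.
  rewrite sumrB -!sum_widen ?undup_uniq// -ys -yt subrr.
  exact: linear_subspace0.
exists [seq v <- s | v \in t], a; split; first exact: filter_uniq.
  move=> v; rewrite mem_filter => /andP[/tD + /sD].
  by rewrite !inE => ? ?; split.
rewrite ys (bigID (mem t))/= [X in _ + X]big_seq_cond.
rewrite [X in _ + X]big1 ?addr0 ?big_filter//.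
by move=> v /andP[vs vt]; rewrite ab// scale0r.
Qed.

(** Steinitz exchange that discards the whole support of [x]: once [x] is expanded, a relation lives
    on the disjoint lists [s] and [t'] in [B], so its coefficients vanish there, and [x != 0] kills
    the coefficient of [x]. *)
Lemma independent_exchange B x (s : seq V) (a : V -> K) :
  linearly_independent B -> x != 0 -> uniq s -> {subset s <= B} ->
  x = \sum_(v <- s) a v *: v ->
  linearly_independent (x |` [set v | B v /\ v \notin x :: s]).
Proof.
move=> indB x0 us sB xE t b ut tD.
pose k := if x \in t then b x else 0.
pose t' := [seq v <- t | v != x].
have -> : \sum_(v <- t) b v *: v = k *: x + \sum_(v <- t') b v *: v.
  rewrite (bigID (pred1 x))/= big_filter; congr (_ + _); rewrite /k.
  have [xt|xt] := boolP (x \in t).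
    by rewrite -big_filter filter_pred1_uniq// big_seq1.
  rewrite scale0r big_seq_cond big1// => v /andP[vt /eqP vx].
  by rewrite -vx vt in xt.
have t'P v : v \in t' -> B v /\ v \notin s.
  rewrite mem_filter => /andP[vx /tD]; rewrite inE => -[/eqP|[Bv]].
    by rewrite (negbTE vx).
  by rewrite inE => /norP[].
rewrite [in k *: _]xE scaler_sumr => st0.
have z v : v \in s ++ t' -> (if v \in s then k * a v else b v) = 0.
  move: v; apply: (indB (s ++ t')).
  - rewrite cat_uniq us filter_uniq// andbT; apply/hasPn => v.
    by move=> /t'P[].
  - by move=> v; rewrite mem_cat => /orP[/sB//|/t'P[Bv _]]; exact: mem_set.
  - rewrite big_cat/= -[RHS]st0; congr (_ + _); apply: eq_big_seq => v.
      by move=> ->; rewrite scalerA.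
    by move=> /t'P[_ /negbTE ->].
have b0 v : v \in t' -> b v = 0.
  move=> vt'; have := z v; rewrite mem_cat vt' orbT => /(_ isT).
  by have [_ /negbTE ->] := t'P _ vt'.
move=> v vt; have [vx|vx] := eqVneq v x; last first.
  by apply: b0; rewrite mem_filter vx.
have : k *: x = 0.
  rewrite xE scaler_sumr big_seq big1// => w ws.
  by rewrite scalerA; have := z w; rewrite mem_cat ws => -> //; rewrite scale0r.
move/eqP; rewrite scaler_eq0 (negbTE x0) orbF /k -vx vt.
by move/eqP.
Qed.

(** If a combination lies in [E], so does its part in [W], which is therefore 0; independence of [D]
    and [c v != 0] then give zero coefficients. *)
Lemma independent_mod_perturb E W D (c : V -> K) (e : V -> V) :
  linear_subspace E -> linear_subspace W -> W `&` E `<=` [set 0] -> D `<=` W ->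
  linearly_independent D -> (forall v, c v != 0) -> (forall v, E (e v)) ->
  independent_mod E (fun v => c v *: v + e v) D.
Proof.
move=> sE sW WE DW indD c0 Ee s a us sD.
under eq_bigr do rewrite scalerDr scalerA.
rewrite big_split/= => Es v vs.
have Ws : W (\sum_(v <- s) (a v * c v) *: v).
  by apply: linear_subspace_sum => // w /sD /set_mem /DW.
have sum0 : \sum_(v <- s) (a v * c v) *: v = 0.
  apply: WE; split=> //.
  rewrite -[X in E X](addrK (\sum_(v <- s) a v *: e v)) addrC -scaleN1r.
  by apply: linear_subspaceD => //; exact: linear_subspace_sum.
have /eqP := indD s (fun v => a v * c v) us sD sum0 v vs.
by rewrite mulf_eq0 (negbTE (c0 v)) orbF => /eqP.
Qed.

End IndexedSpan.

(** * Approximation from a dense set, and tails of injections *)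

(** Take [e] in both [E] and [U]: as [c] tends to 0, [c *: v + e] tends to [e], so it enters [U] for
    some nonzero [c]. *)
Lemma dense_perturb (K : numFieldType) (V : topologicalLmodType K)
    (E U : set V) (v : V) :
  dense E -> open U -> U !=set0 ->
  exists (c : K) (e : V), [/\ c != 0, E e & U (c *: v + e)].
Proof.
move=> dE oU U0; have [e [Ue Ee]] := dE _ U0 oU.
have cvg_e : (fun c : K^o => c *: v + e) @ nbhs (0 : K^o) --> e.
  rewrite -[X in _ --> X]add0r -(scale0r v).
  apply: continuous2_cvg; last exact: cvg_cst.
    exact: (@tvs.add_continuous V (0 *: v, e)).
  apply: continuous2_cvg; [|exact: cvg_id|exact: cvg_cst].
  exact: (@scale_continuous K V ((0 : K^o), v)).
have : \forall c \near (0 : K^o)^', U (c *: v + e).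
  apply: cvg_within; apply: cvg_e; exact: open_nbhs_nbhs.
move=> Unear.
have [c [Uc c0]] := @filter_ex _ _ (Proper_dnbhs_regular_numFieldType (0 : K^o)) _
  (filterI Unear (@nbhs_dnbhs_neq _ (0 : K^o))).
by exists c, e.
Qed.

Lemma inj_tail_avoid (T : Type) (U : eqType) (A : set T) (g : T * nat -> U)
    (r : seq U) : {in A `*` setT &, injective g} ->
  exists n0, forall h n, A h -> g (h, (n + n0)%N) \notin r.
Proof.
move=> ginj; elim: r => [|z r [n1 n1P]]; first by exists 0%N.
have [[h [n [Ah gz]]]|nz] := pselect (exists h n, A h /\ g (h, n) = z).
  (* By injectivity [(h, n)] is the only preimage of [z]: [n.+1] passes it, and [n1] still avoids
     the rest of [r]. *)
  exists (n.+1 + n1)%N => h' n' Ah'; rewrite inE negb_or addnA n1P// andbT.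
  apply/eqP; rewrite -gz => /ginj e.
  have [_ /eqP] := e (mem_set (conj Ah' I)) (mem_set (conj Ah I)).
  by rewrite addnS addSn gtn_eqF// ltnS -addnA addnCA leq_addr.
exists n1 => h n Ah; rewrite inE negb_or n1P// andbT.
by apply/eqP => gz; apply: nz; exists h, (n + n1)%N.
Qed.

(** * Construction of the dense subspaces through [x] *)

Theorem theorem4p1
  (K : numFieldType) (K_RC : is_real_or_complex K)
  (V : topologicalLmodType K)
  (J : Type) (kappa : set J) (kappa_weight : is_weight V kappa)
  (I : Type) (alpha : set I) (alpha_infinite : infinite_set alpha)
  (weight_le_alpha : kappa #<= alpha)
  (M : set V) (M_neq0 : M !=set0)
  (exN : exists N : set V,
     [/\ N !=set0, stronger M N, M `&` N = set0 & dense_lineable N])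
  (M_lineable : pointwise_lineable alpha M) :
  infinitely_pointwise_dense_lineable alpha M.
Proof.
move=> x Mx.
have [N [[z Nz] MN MN0 [E [sE dE EN]]]] := exN.
(* Otherwise [z = 0 + z] would lie in both [M] and [N]. *)
have M0 : ~ M 0.
  move=> M0; have : (M `&` N) z.
    by split=> //; apply: MN; exists 0 => //; exists z => //; rewrite add0r.
  by rewrite MN0.
have MDE m e : M m -> E e -> M (m + e).
  move=> Mm /EN[Ne|->]; last by rewrite addr0.
  by apply: MN; exists m => //; exists e.
have x0 : x != 0 by apply/eqP => xE; apply: M0; rewrite -xE.
have [W [sW Wx [H [indH spanH] Ha] WM]] := M_lineable x Mx.
have WE : W `&` E `<=` [set 0].
  move=> y [/WM[My|->//] /EN[Ny|->//]].
  have : (M `&` N) y by [].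
  by rewrite MN0.
have HW : H `<=` W by rewrite -spanH; exact: sub_linear_span.
have Hinf : infinite_set H by rewrite (eq_finite_set Ha).
have H0 := infinite_setN0 Hinf.
have [g gH ginj] := card_le_inj_homo (card_setX_nat Hinf) H0.
have [B basB Bk] := kappa_weight.1.
(* [i] labels the basic open sets by vectors of [H], using that the weight is at most [alpha]. *)
have [i iH iinj] : exists2 i : set V -> V,
    {homo i : U / B U >-> H U} & {in B &, injective i}.
  apply: card_le_inj_homo => //.
  by rewrite (card_le_eql Bk) (card_le_eqr Ha).
have [s [a [us sH xE]]] : indexed_span id H x.
  by rewrite -linear_span_indexed spanH.
(* Shifting by n0 keeps all the chosen basis vectors off the support of x. *)
have [n0 n0P] := inj_tail_avoid (x :: s) ginj.
pose w n h := g (h, (n + n0)%N).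
have wx n h : H h -> w n h <> x.
  by move=> /(n0P _ n); rewrite inE => /norP[/eqP].
have winj m n h h' : H h -> H h' -> w m h = w n h' -> h = h' /\ m = n.
  move=> Hh Hh' /ginj e.
  have [-> /eqP] := e (mem_set (conj Hh Logic.I)) (mem_set (conj Hh' Logic.I)).
  by rewrite eqn_add2r => /eqP.
(* [p v] holds the scalar and the translation applied to [v]: [x] stays fixed, [w n (i U)] is sent
   into a nonempty [U], and any other vector gets the trivial pair [(1, 0)]. *)
have /choice[p pP] : forall v, exists p : K * V,
    [/\ p.1 != 0, E p.2, v = x -> p = (1, 0) &
      forall U n, B U -> U !=set0 -> v = w n (i U) -> U (p.1 *: v + p.2)].
  move=> v; have E0 := linear_subspace0 sE.
  have [->|vx] := pselect (v = x).
    exists (1, 0); split=> //=; first by rewrite oner_eq0.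
    by move=> U n BU _ xw; exfalso; apply: (wx n (i U)) => //; exact: iH.
  have [[U [n [BU U0 vU]]]|nU] := pselect (exists U n,
      [/\ B U, U !=set0 & v = w n (i U)]).
    have [c [e [c0 Ee Ue]]] := dense_perturb v dE (basB.1 _ BU) U0.
    exists (c, e); split=> //= U' n' BU' _.
    (* By injectivity of [w] and [i], [v] comes from a single [U], so the requirements never
       conflict. *)
    rewrite vU => /(winj _ _ _ _ (iH _ BU) (iH _ BU'))[+ _].
    by move=> /iinj <-; rewrite ?inE// -vU.
  exists (1, 0); split=> //=; first by rewrite oner_eq0.
  by move=> U n BU U0 vU; exfalso; apply: nU; exists U, n.
pose u v := (p v).1 *: v + (p v).2.
have ux : u x = x.
  by rewrite /u; have [_ _ /(_ erefl) -> _] := pP x; rewrite scale1r addr0.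
(* [D n] indexes a basis of the n-th subspace; [D'] contains every [D n], so a single independence
   statement covers them and their unions. *)
pose D n := x |` w n @` H.
pose D' := x |` [set v | H v /\ v \notin x :: s].
have D'W : D' `<=` W by move=> v [->//|[/HW]].
have DD' n : D n `<=` D'.
  by move=> _ [->|[h Hh <-]]; [left|right; split; [exact: gH|exact: n0P]].
have indu : independent_mod E u D'.
  apply: independent_mod_perturb WE _ _ _ _ => //.
  - exact: independent_exchange xE.
  - by move=> v; have [] := pP v.
  - by move=> v; have [] := pP v.
have indD n : independent_mod E u (D n) by exact: independent_mod_sub indu.
exists (fun n => linear_span (u @` D n)); split=> [n|m n mn].
  split.
  - exact: linear_span_subspace.
  - move=> O [y Oy] oO.
    (* A basic [U] inside [O] contains the perturbed vector assigned to it. *)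
    have [U [BU Uy] UO] := basB.2 y O (open_nbhs_nbhs (conj oO Oy)).
    have [_ _ _ /(_ U n BU (ex_intro _ y Uy) erefl) Uu] := pP (w n (i U)).
    exists (u (w n (i U))); split; first exact: UO.
    apply: sub_linear_span; exists (w n (i U)) => //.
    by right; exists (i U) => //; exact: iH.
  - exists (u @` D n).
      by split=> //; exact: independent_mod_image (indD n).
    apply: card_eq_trans Ha; rewrite card_eq_le; apply/andP; split.
      apply: card_le_trans (card_image_le _ _) _.
      apply: card_le_trans (card_setX_nat Hinf).
      (* [D n] is covered by an image of [H * nat]: second coordinate 0 yields [x], any other yields
         [w n h]. *)
      apply: (@card_le_trans _ _ _
        ((fun q => if q.2 == 0%N then x else w n q.1) @` (H `*` setT))).
        apply: subset_card_le => _ [->|[h Hh <-]].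
          by have [h Hh] := H0; exists (h, 0%N).
        by exists (h, 1%N).
      exact: card_image_le.
    apply: (@inj_homo_card_le _ _ _ _ (u \o w n)).
      by move=> h Hh; exists (w n h) => //; right; exists h.
    move=> h h' /set_mem Hh /set_mem Hh' /= uw.
    have [] // : h = h' /\ n = n.
    apply: winj => //; apply: (independent_mod_inj sE (indD n)) => //.
    - by apply/mem_set; right; exists h.
    - by apply/mem_set; right; exists h'.
  - by apply: sub_linear_span; exists x => //; left.
  - rewrite linear_span_image => _ [t [b [ut tD ->]]].
    have [t0|tn0] := eqVneq (\sum_(v <- t) b v *: u v) 0; [by right|left].
    move: tn0; rewrite /u.
    under eq_bigr do rewrite scalerDr scalerA.
    rewrite big_split/=; set S1 := \sum_(v <- t) _; set S2 := \sum_(v <- t) _.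
    have ES2 : E S2.
      by apply: linear_subspace_sum => // v _; have [] := pP v.
    (* If [S1] is in [M], adding [S2] stays in [M]. If [S1 = 0], the combination lies in [E], so
       independence modulo [E] makes it zero, a case already set aside. *)
    have /WM[MS1 _|S10] : W S1.
      by apply: linear_subspace_sum => // v /tD /set_mem /DD' /D'W.
    - exact: MDE.
    - suff b0 : {in t, forall v, b v = 0}.
        by rewrite /S1 /S2 !big_seq !big1 ?addr0 ?eqxx// => v /b0 ->;
          rewrite ?mul0r scale0r.
      apply: (indD n) => //; rewrite /u.
      under eq_bigr do rewrite scalerDr scalerA.
      by rewrite big_split/= -/S1 -/S2 S10 add0r.
(* Both families lie in one independent family, so the spans meet in the span of the common indices,
   and [x] is the only one. *)
have -> : linear_span (u @` D m) `&` linear_span (u @` D n) =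
    indexed_span u [set x].
  rewrite !linear_span_image (indexed_spanI sE).
    congr indexed_span; apply/seteqP; split=> [v|_ ->]; last by split; left.
    by move=> [[->//|[h Hh <-]] [//|[h' Hh' /(winj _ _ _ _ Hh' Hh)[_ /esym]]]].
  by apply: independent_mod_sub indu => v [] /DD'.
apply/seteqP; split=> [_ [t [b [_ tx ->]]]|_ [k _ <-]].
  exists (\sum_(v <- t) b v) => //; rewrite scaler_suml.
  by apply: eq_big_seq => v /tx; rewrite inE => ->; rewrite ux.
apply: linear_subspaceZ (indexed_span_subspace _ _) _.
by rewrite -[X in indexed_span _ _ X]ux; exact: sub_indexed_span.
Qed.
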